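(* Let $G=(V,E)$ be a graph with set of spanning trees $\mathcal{T}(G)$. For each of the three types of distribution (non-separable, positive, log-linear) the following holds: $G$ is resistance nonnegative (respectively, resistance positive) if and only if there exists a distribution $\mu$ on $\mathcal{T}(G)$ of that type such that for every vertex $v\in V$ the expected degree $\sum_{T\in\mathcal{T}(G)}\mu(T)\deg_T(v)$ of $v$ in a random spanning tree distributed according to $\mu$ is at most $2$ (respectively, strictly smaller than $2$).
   Context: All graphs $G=(V,E)$ are finite, simple (no multi-edges), loopless and connected. A spanning tree of $G$ is a maximal acyclic subset of edges $T\subseteq E$; $\mathcal{T}(G)$ is the set of all spanning trees, and $\deg_T(v)$ is the number of edges of $T$ incident to $v$. Resistance curvature: for edge weights $c=(c_e)_{e\in E}$ with $0<c_e<\infty$, the relative resistance of $e\in E$ is $r_e(c)=\frac{\sum_{T\ni e}\prod_{t\in T}c_t}{\sum_{T}\prod_{t\in T}c_t}$, with sums over $T\in\mathcal{T}(G)$, and the resistance curvature of $v\in V$ is $p_v(c)=1-\frac12\sum_{uv\in E}r_{uv}(c)$ (sum over edges incident to $v$). $G$ is resistance nonnegative (RN) if there exist weights $c$ with $p_v(c)\ge 0$ for all $v\in V$, and resistance positive (RP) if there exist weights $c$ with $p_v(c)>0$ for all $v\in V$. Distributions: a distribution on $\mathcal{T}(G)$ is a probability distribution $\mu:\mathcal{T}(G)\to[0,1]$. It is log-linear if $\mu(T)=\prod_{t\in T}c_t\big/\sum_{T'}\prod_{t\in T'}c_t$ for some weights $0<c<\infty$. It is positive if $\mu(T)>0$ for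 all $T$. For $T\subseteq E$ let $e_T=\sum_{i\in T}e_i\in\mathbb{R}^E$, with $(e_i)_{i\in E}$ the standard basis, and let $P(G)=\operatorname{conv}(e_T\mid T\in\mathcal{T}(G))$ be the spanning tree polytope, with relative interior $P(G)^\circ$ (taken in its affine hull). A subset $\mathcal{F}\subseteq\mathcal{T}(G)$ is non-separable if $\operatorname{conv}(e_T\mid T\in\mathcal{F})$ intersects $P(G)^\circ$. A distribution is non-separable if its support is a non-separable subset. *)

(* Defs.v *)
From mathcomp Require Import all_boot all_order all_algebra.
From mathcomp Require Import all_classical all_reals all_analysis.

Set Implicit Arguments.
Unset Strict Implicit.
Unset Printing Implicit Defensive.

Import Order.TTheory GRing.Theory Num.Theory.
Import numFieldNormedType.Exports.

Local Open Scope ring_scope.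

(* A simple graph is a symmetric irreflexive relation on a finite type of
   vertices. An edge is the unordered pair of its two endpoints. *)
Definition simple_connected_graph (V : finType) (adj : rel V) : Prop :=
  [/\ symmetric adj, irreflexive adj & forall u v : V, connect adj u v].

Definition edge (V : finType) (adj : rel V) : finType :=
  {f : {set V} | [exists u, exists v, adj u v && (f == [set u; v]%SET)]}.

Definition edge_adj (V : finType) (adj : rel V) (F : {set edge adj}) : rel V :=
  fun u v => [exists f in F, val f == [set u; v]%SET].

(* Closed walks of length 2, which traverse one edge back and forth, are
   ucycles for the library but not cycles of a simple graph. *)
Definition acyclic (V : finType) (adj : rel V) (F : {set edge adj}) : Prop :=
  ~ exists s : seq V, (2 < size s)%N /\ ucycle (edge_adj F) s.

Definition sptree (V : finType) (adj : rel V) : finType :=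
  {T : {set edge adj} | maxset (fun F => `[< acyclic F >]) T}.

Definition deg (V : finType) (adj : rel V) (T : sptree adj) (v : V) : nat :=
  #|[set f in val T | v \in val f]%SET|.

Section Resistance.
Context (R : realType) (V : finType) (adj : rel V).

Definition weights (c : edge adj -> R) : Prop := forall f, 0 < c f.

Definition tree_weight (c : edge adj -> R) (T : sptree adj) : R :=
  \prod_(t in val T) c t.

Definition rel_resistance (c : edge adj -> R) (f : edge adj) : R :=
  (\sum_(T : sptree adj | f \in val T) tree_weight c T)
  / (\sum_(T : sptree adj) tree_weight c T).

Definition curvature (c : edge adj -> R) (v : V) : R :=
  1 - 2^-1 * \sum_(f : edge adj | v \in val f) rel_resistance c f.

Definition resistance_nonnegative : Prop :=
  exists c : edge adj -> R, weights c /\ forall v, 0 <= curvature c v.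

Definition resistance_positive : Prop :=
  exists c : edge adj -> R, weights c /\ forall v, 0 < curvature c v.

End Resistance.
Arguments resistance_nonnegative R {V} adj.
Arguments resistance_positive R {V} adj.

Definition convex_hull (R : realType) (W : lmodType R) (A : set W) : set W :=
  fun x => exists (n : nat) (a : 'I_n -> R) (p : 'I_n -> W),
    [/\ forall i, 0 <= a i, \sum_i a i = 1, forall i, A (p i)
      & x = \sum_i a i *: p i].

Definition affine_hull (R : realType) (W : lmodType R) (A : set W) : set W :=
  fun x => exists (n : nat) (a : 'I_n -> R) (p : 'I_n -> W),
    [/\ \sum_i a i = 1, forall i, A (p i) & x = \sum_i a i *: p i].

Definition relative_interior (R : realType) (W : normedModType R)
    (A : set W) : set W :=
  fun x => A x /\ within (affine_hull A) (nbhs x) A.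

Section Distributions.
Context (R : realType) (V : finType) (adj : rel V).

(* The coordinates of R^E are indexed through [enum_rank]. *)
Definition tree_vector (T : sptree adj) : 'rV[R]_#|edge adj| :=
  \sum_(f in val T) delta_mx 0 (enum_rank f).

Definition tree_polytope : set 'rV[R]_#|edge adj| :=
  convex_hull (range tree_vector).

Definition nonseparable (F : {set sptree adj}) : Prop :=
  exists x, convex_hull (tree_vector @` [set` F])%classic x
    /\ relative_interior tree_polytope x.

Definition tree_distribution (mu : sptree adj -> R) : Prop :=
  (forall T, 0 <= mu T <= 1) /\ \sum_T mu T = 1.

Definition expected_degree (mu : sptree adj -> R) (v : V) : R :=
  \sum_T mu T * (deg T v)%:R.

End Distributions.

Variant distr_type := NonSeparable | Positive | LogLinear.

Definition has_type (R : realType) (V : finType) (adj : rel V)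
    (k : distr_type) (mu : sptree adj -> R) : Prop :=
  match k with
  | NonSeparable => nonseparable R [set T | mu T != 0]%SET
  | Positive => forall T, 0 < mu T
  | LogLinear => exists c : edge adj -> R, weights c /\
      forall T, mu T = tree_weight c T / \sum_(T' : sptree adj) tree_weight c T'
  end.

(* Main.v *)
(* For log-linear weights the curvature of [v] is [1 - d / 2], where [d] is the
   expected degree of [v], and expected degrees depend on a distribution [mu]
   only through its mean [\sum_T mu T *: e_T]. So it suffices that the mean of a
   non-separable distribution is also the mean of a log-linear one. A point of
   the relative interior is a convex combination of the [e_T] with all
   coefficients positive; mixing a little of it into a non-separable [mu] makes
   all coefficients of the mean [x] of [mu] positive too. Then
   [th |-> \sum_T exp <th, e_T - x>] attains its minimum, and at a minimiser the
   weights [c = exp th] have mean [x]. Conversely a positive distribution is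
   non-separable, because near its mean barycentric coordinates can be chosen
   continuously on the affine hull. *)
Require Import Defs.
From mathcomp Require Import all_boot all_order all_algebra.
From mathcomp Require Import all_classical all_reals all_analysis.

Import Order.TTheory GRing.Theory Num.Theory.
Import numFieldNormedType.Exports.
Local Open Scope ring_scope.

(** * Exponential weights with a prescribed mean *)

Lemma mulmxr_entry_continuous (R : realType) (m n : nat) (B : 'M[R]_(m, n))
    (j : 'I_n) : continuous (fun y : 'rV[R]_m => (y *m B) ord0 j).
Proof.
rewrite (_ : (fun _ => _) = fun y : 'rV[R]_m => \sum_k y ord0 k * B k j); last first.
  by apply/funext => y; rewrite mxE.
apply: continuous_big; first exact: add_continuous.
move=> k _ y; apply: (@continuousM R _ (fun y : 'rV[R]_m => y ord0 k) (cst (B k j))).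
  exact: (@coord_continuous R 1 m ord0 k y).
exact: cst_continuous.
Qed.

(** The row space is the common zero set of the entries of [y *m cokermx A], which are continuous in
    [y]. *)
Lemma closed_row_space (R : realType) (m n : nat) (A : 'M[R]_(n, m)) :
  closed [set y : 'rV[R]_m | (y <= A)%MS]%classic.
Proof.
rewrite (_ : [set _ | _]%classic =
  (\bigcap_(j in setT) ((fun y : 'rV[R]_m => (y *m cokermx A) ord0 j) @^-1`
     [set x | x = 0]))%classic).
  apply: closed_bigI => j _; apply: preimage_closed; last exact: closed_eq.
  by move=> y _; exact: mulmxr_entry_continuous.
apply/seteqP; split => y /=; rewrite submxE.
  by move=> /eqP y0 j _ /=; rewrite y0 mxE.
move=> y0; apply/eqP/matrixP => i j; rewrite (ord1 i) [RHS]mxE.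
exact: y0.
Qed.

(* The equation is the stationarity condition of [y |-> \sum_i expR y_i] on the
   row space of [A]. The minimum is attained: on that space
   [\sum_i nu_i y_i = 0], so upper bounds on all the [y_i] give lower bounds. *)
Lemma exp_stationary_row (R : realType) (m n : nat) (A : 'M[R]_(n, m)) (nu : 'cV[R]_m) :
  (forall i, 0 < nu i 0) -> A *m nu = 0 ->
  exists th : 'rV[R]_n, A *m (\col_i expR ((th *m A) 0 i)) = 0.
Proof.
move=> nu0 Anu.
pose S (y : 'rV[R]_m) : R := \sum_i expR (y ord0 i).
(* [C] bounds every coordinate of a row [y] in the row space with [S y <= S 0 = m]. Above,
   [y_i <= expR y_i <= m]; below, [nu_i y_i] is minus the sum of the other [nu_k y_k], hence at
   least [- (\sum_j nu_j) m]. Summing over [i] makes the bound uniform. *)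
pose C : R := m%:R + \sum_i (\sum_j nu j 0) * m%:R / nu i 0.
have sum_nu_ge0 : 0 <= \sum_j nu j 0 by apply: sumr_ge0 => j _; exact/ltW.
pose K : set 'rV[R]_m := ([set y : 'rV[R]_m | (y <= A)%MS] `&`
  [set y | forall i, `[- C, C]%classic (y ord0 i)])%classic.
have S_cont : continuous S.
  apply: continuous_big; first exact: add_continuous.
  move=> i _ y; apply: (continuous_comp (f := fun y : 'rV[R]_m => y ord0 i)).
    exact: (@coord_continuous R 1 m ord0 i).
  exact: continuous_expR.
have C_ge0 : 0 <= C.
  rewrite addr_ge0 // sumr_ge0 // => i _.
  by rewrite divr_ge0 ?mulr_ge0 // ltW.
have le_term i : (\sum_j nu j 0) * m%:R / nu i 0 <=
    \sum_i (\sum_j nu j 0) * m%:R / nu i 0.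
  rewrite [leRHS](bigD1 i) //= lerDl sumr_ge0 // => j _.
  by rewrite divr_ge0 ?mulr_ge0 // ltW.
have S0 : S 0 = m%:R.
  rewrite /S (eq_bigr (fun=> 1)); last by move=> i _; rewrite mxE expR0.
  by rewrite sumr_const card_ord.
have sublevel y : (y <= A)%MS -> S y <= m%:R -> K y.
  move=> yA Sy; split=> //= i.
  have up k : y ord0 k <= m%:R.
    apply: le_trans Sy; apply: (@le_trans _ _ (expR (y ord0 k))).
      by apply: le_trans (expR_ge1Dx _); rewrite lerDr.
    by rewrite /S (bigD1 k) //= lerDl sumr_ge0 // => l _; exact: expR_ge0.
  have ynu : \sum_k y ord0 k * nu k 0 = 0.
    have /submxP[th ->] := yA.
    have /matrixP/(_ 0 0) : th *m A *m nu = 0 by rewrite -mulmxA Anu mulmx0.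
    by rewrite !mxE.
  rewrite in_itv /=; apply/andP; split; last first.
    by apply: le_trans (up i) _; rewrite lerDl (le_trans _ (le_term i)) //
      divr_ge0 ?mulr_ge0 // ltW.
  rewrite lerNl; apply: (@le_trans _ _ ((\sum_j nu j 0) * m%:R / nu i 0)); last first.
    by apply: le_trans (le_term i) _; rewrite lerDr.
  rewrite ler_pdivlMr // mulNr.
  move: ynu; rewrite (bigD1 i) //= => /eqP; rewrite addrC addr_eq0 => /eqP <-.
  rewrite mulr_suml [leRHS](bigD1 i) //= -[leLHS]add0r lerD //.
    by rewrite mulr_ge0 // ltW.
  by apply: ler_sum => k _; rewrite mulrC ler_wpM2l // ltW.
have K_compact : compact K.
  rewrite /K setIC; apply: compact_closedI; last exact: closed_row_space.
  by apply: (rV_compact (A := fun=> `[- C, C]%classic)) => i; exact: segment_compact.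
have K0 : K 0 by apply: sublevel; rewrite ?sub0mx // S0.
have [y yK ymin] : exists2 y, y \in K & forall z, z \in K -> S y <= S z.
  apply: EVT_min_rV => //; first by exists 0.
  exact: continuous_subspaceT.
(* The minimum over [K] is global on the row space: outside the sublevel set [S z] exceeds
   [m = S 0], and [0] lies in [K]. *)
have {}ymin z : (z <= A)%MS -> S y <= S z.
  move=> zA; have [Sz|/ltW Sz] := leP (S z) m%:R.
    by apply: ymin; rewrite inE; exact: sublevel.
  by apply: le_trans Sz; rewrite -S0; apply: ymin; rewrite inE.
have {yK} [/submxP[th yE] _] : K y by rewrite inE in yK.
exists th; rewrite -yE; apply/matrixP => f i; rewrite (ord1 i) !mxE.
(* Moving [y] along row [f] of [A] stays in the row space, so [\sum_k g k] is minimal at 0. Its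
   derivative there is coordinate [f] of the required equation. *)
pose g (k : 'I_m) (t : R) : R := expR (y ord0 k + t * A f k).
have g_derive (k : 'I_m) (t : R) :
    is_derive t (1 : R) (g k) (expR (y ord0 k + t * A f k) * A f k).
  have lin : is_derive t (1 : R) (fun u : R => y ord0 k + u * A f k) (A f k).
    rewrite (_ : (fun _ => _) = cst (y ord0 k) + A f k *: (id : R -> R)); last first.
      by apply/funext => u; rewrite /= mulrC.
    by apply: is_derive_eq; rewrite add0r [LHS]mulr1.
  exact: (is_derive1_comp (is_derive_expR _) lin).
have G_derive (t : R) := is_derive_sum (g_derive ^~ t).
have G0 : is_derive (0 : R) (1 : R) (\sum_k g k) 0.
  apply: (@derive1_at_min _ _ (-1) 1).
  - by rewrite ge0_cp.
  - by move=> t _; have [] := G_derive t.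
  - by rewrite in_itv /= ltrN10 ltr01.
  move=> t _; rewrite !fct_sumE.
  have -> : \sum_k g k 0 = S y by apply: eq_bigr => k _; rewrite /g mul0r addr0.
  have -> : \sum_k g k t = S (y + t *: row f A).
    by apply: eq_bigr => k _; rewrite /g !mxE.
  by apply: ymin; rewrite addmx_sub ?yE ?submxMl // scalemx_sub // row_sub.
have := @derive_val _ _ _ _ _ _ _ G0.
rewrite (@derive_val _ _ _ _ _ _ _ (G_derive 0)) => sum0.
rewrite -[RHS]sum0; transitivity (\sum_k expR (y ord0 k + 0 * A f k) * A f k) => //.
by apply: eq_bigr => k _; rewrite mxE mul0r addr0 mulrC.
Qed.

(** Apply [exp_stationary_row] to the matrix with columns [p i - x], which annihilates [nu] because
    [x] is the mean. The resulting weights differ from [w] only by the common factor [expR (- c)],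
    which cancels. *)
Lemma log_linear_mean (R : realType) (I : finType) (n : nat) (p : I -> 'rV[R]_n)
    (nu : I -> R) :
  (forall i, 0 < nu i) -> \sum_i nu i = 1 ->
  exists th : 'rV[R]_n, let w i := expR (\sum_j th 0 j * p i 0 j) in
    \sum_i w i *: p i = (\sum_i w i) *: (\sum_i nu i *: p i).
Proof.
move=> nu0 nu1; set x := \sum_i nu i *: p i.
pose A : 'M[R]_(n, #|I|) := \matrix_(j, i) (p (enum_val i) - x) 0 j.
have A_sum (w : I -> R) (j : 'I_n) :
    (A *m \col_i w (enum_val i)) j 0 = (\sum_i w i *: (p i - x)) 0 j.
  rewrite mxE summxE [RHS](reindex _ (onW_bij _ (enum_val_bij I))) /=.
  by apply: eq_bigr => i _; rewrite !mxE mulrC.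
have [||th th0] := @exp_stationary_row R _ _ A (\col_i nu (enum_val i)).
- by move=> i; rewrite mxE.
- apply/matrixP => j k; rewrite (ord1 k) A_sum.
  under eq_bigr do rewrite scalerBr.
  by rewrite sumrB -scaler_suml nu1 scale1r subrr !mxE.
exists th; pose c := \sum_j th 0 j * x 0 j.
set w := fun i => _; rewrite /=.
have thA i : (th *m A) 0 i = \sum_j th 0 j * p (enum_val i) 0 j - c.
  rewrite mxE /c -sumrB; apply: eq_bigr => j _.
  by rewrite !mxE mulrBr.
apply/eqP; rewrite -subr_eq0 scaler_suml -sumrB; apply/eqP.
apply/matrixP => i0 j; rewrite (ord1 i0) [RHS]mxE.
have /matrixP/(_ j 0) := th0; rewrite [RHS]mxE.
rewrite (_ : \col_i _ = expR (- c) *: \col_i w (enum_val i)); last first.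
  by apply/matrixP => i k; rewrite [LHS]mxE thA expRD mulrC [RHS]mxE [in RHS]mxE.
rewrite -scalemxAr mxE A_sum => /eqP; rewrite mulf_eq0 expR_eq0 /= => /eqP <-.
by congr (fun_of_matrix _ _ _); apply: eq_bigr => i _; rewrite scalerBr.
Qed.

(** * Convex hulls of finite families and their relative interiors *)

Lemma convex_hullP (R : realType) (W : lmodType R) (I : finType) (p : I -> W)
    (F : {set I}) (y : W) :
  convex_hull (p @` [set` F])%classic y <->
  exists w : I -> R, [/\ forall i, 0 <= w i, \sum_(i in F) w i = 1
    & y = \sum_(i in F) w i *: p i].
Proof.
split=> [[n [a [q [a0 a1 qF ->]]]]|[w [w0 w1 ->]]].
  have [s sP] : exists s : 'I_n -> I, forall k, s k \in F /\ p (s k) = q k.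
    suff: forall k, exists i, i \in F /\ p i = q k by move=> /choice[s]; exists s.
    by move=> k; have [i iF <-] := qF k; exists i.
  have sF k : true -> s k \in F by move=> _; have [] := sP k.
  (* Coefficients of points assigned the same index are merged. *)
  exists (fun i => \sum_(k | s k == i) a k); split.
  - by move=> i; exact: sumr_ge0.
  - by rewrite -a1 [RHS](partition_big s (mem F)).
  - rewrite [LHS](partition_big s (mem F)) //=; apply: eq_bigr => i _.
    rewrite scaler_suml; apply: eq_bigr => k /eqP <-.
    by have [_ ->] := sP k.
exists #|F|, (w \o enum_val), (p \o enum_val); split => //=.
- by rewrite -w1 [RHS]big_enum_val.
- by move=> k; exists (enum_val k) => //; exact: enum_valP.
- by rewrite [LHS]big_enum_val.
Qed.

Lemma convex_hull_rangeP (R : realType) (W : lmodType R) (I : finType) (p : I -> W)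
    (y : W) :
  convex_hull (range p) y <->
  exists w : I -> R, [/\ forall i, 0 <= w i, \sum_i w i = 1
    & y = \sum_i w i *: p i].
Proof.
have -> : range p = (p @` [set` [set: I]%SET])%classic.
  by congr image; apply/seteqP; split => i //= _; rewrite inE.
apply: (iff_trans (convex_hullP _ _ _ _ _ _)).
by split=> -[w [w0 w1 ->]]; exists w; split=> //; try (rewrite -w1);
  apply: eq_bigl => i; rewrite inE.
Qed.

(** The segment from the barycentre [b] to [x] can be prolonged slightly beyond [x] inside the hull,
    to [f d]. Then [x = (f d + d b) / (1 + d)], and the share of [b] makes every coefficient
    positive. *)
Lemma relative_interior_mean (R : realType) (I : finType) (n : nat)
    (p : I -> 'rV[R]_n) (x : 'rV[R]_n) :
  relative_interior (convex_hull (range p)) x ->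
  exists nu : I -> R,
    [/\ forall i, 0 < nu i, \sum_i nu i = 1 & x = \sum_i nu i *: p i].
Proof.
move=> [Px]; rewrite /within/= => nx.
have /convex_hull_rangeP [w [w0 w1 _]] := Px.
have I0 : (0 < #|I|)%N.
  rewrite lt0n; apply/eqP => I0; move: w1; rewrite big_pred0 => [/eqP|i].
    by rewrite eq_sym oner_eq0.
  by have := card0_eq I0 i.
pose b := \sum_i #|I|%:R^-1 *: p i : 'rV[R]_n.
have b1 : \sum_(i : I) #|I|%:R^-1 = 1 :> R.
  by rewrite sumr_const -[_ *+ _]mulr_natr mulVf // pnatr_eq0 -lt0n.
have Pb : convex_hull (range p) b.
  by apply/convex_hull_rangeP; exists (fun=> #|I|%:R^-1); split.
pose f (e : R) : 'rV[R]_n := x + e *: (x - b).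
have f_aff e : affine_hull (convex_hull (range p)) (f e).
  exists 2, (fun k => if k == ord0 then 1 + e else - e),
    (fun k => if k == ord0 then x else b); split.
  - by rewrite !big_ord_recl big_ord0 /= addr0 addrK.
  - by move=> k; case: ifP.
  - rewrite !big_ord_recl big_ord0 /= addr0 /f scalerBr scalerDl scale1r.
    by rewrite scaleNr addrA.
have f_cont : (f e @[e --> (0 : R)] --> f 0)%classic.
  apply: cvgD; first exact: cvg_cst.
  by apply: cvgZr_tmp; exact: cvg_id.
have f0 : f 0 = x by rewrite /f scale0r addr0.
have /nbhs_ballP[e /= e0 He] : nbhs (0 : R) (f @^-1` [set y |
    affine_hull (convex_hull (range p)) y -> convex_hull (range p) y])%classic.
  by move: f_cont; rewrite f0; apply.
have /convex_hull_rangeP [v [v0 v1 fE]] : convex_hull (range p) (f (e / 2)).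
  apply: He (f_aff _); rewrite /ball /= sub0r normrN gtr0_norm ?divr_gt0 //.
  by rewrite ltr_pdivrMr // ltr_pMr // ltr1n.
set d := e / 2 in fE; have d0 : 0 < d by rewrite divr_gt0.
have d1 : 0 < 1 + d by rewrite addr_gt0.
exists (fun i => (1 + d)^-1 * (v i + d * #|I|%:R^-1)); split.
- move=> i; rewrite mulr_gt0 ?invr_gt0 // ltr_wpDl // mulr_gt0 // invr_gt0.
  by rewrite ltr0n.
- by rewrite -mulr_sumr big_split /= -mulr_sumr v1 b1 mulr1 mulVf // gt_eqF.
- under eq_bigr do rewrite -scalerA scalerDl -scalerA.
  rewrite -scaler_sumr big_split /= -scaler_sumr -fE -/b /f scalerBr addrA subrK.
  by rewrite -{2}[x]scale1r -scalerDl scalerA mulVf ?scale1r // gt_eqF.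
Qed.

(** The pseudo-inverse of [D] gives coordinates [b z] of [z - x] in terms of the [p i - x]. They are
    continuous in [z] and vanish at [x]. *)
Lemma mean_relative_interior (R : realType) (I : finType) (n : nat)
    (p : I -> 'rV[R]_n) (nu : I -> R) :
  (forall i, 0 < nu i) -> \sum_i nu i = 1 ->
  relative_interior (convex_hull (range p)) (\sum_i nu i *: p i).
Proof.
move=> nu0 nu1; set x := \sum_i nu i *: p i.
split; first by apply/convex_hull_rangeP; exists nu; split=> // i; exact: ltW.
pose D : 'M[R]_(#|I|, n) := \matrix_(i < #|I|) (p (enum_val i) - x).
pose b (z : 'rV[R]_n) (i : I) : R := ((z - x) *m pinvmx D) ord0 (enum_rank i).
(* The multiple of [nu] brings the total to 1. It does not move the represented point, since the
   [nu i *: (p i - x)] sum to 0. As [w x = nu], all coefficients stay positive near [x]. *)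
pose w (z : 'rV[R]_n) (i : I) : R := b z i + (1 - \sum_k b z k) * nu i.
have b_cont i : continuous (b ^~ i).
  rewrite (_ : b ^~ i = (fun z : 'rV[R]_n => (z *m pinvmx D) ord0 (enum_rank i)) +
      cst (- (x *m pinvmx D) ord0 (enum_rank i))); last first.
    by apply/funext => z; rewrite /b mulmxBl [LHS]mxE; congr (_ + _); rewrite [LHS]mxE.
  move=> z; apply: continuousD; last exact: cst_continuous.
  exact: mulmxr_entry_continuous.
have w_cont i : continuous (w ^~ i).
  move=> z; apply: (@continuousD _ _ _ (b ^~ i)); first exact: b_cont.
  apply: (@continuousM _ _ (fun z => 1 - \sum_k b z k)); last exact: cst_continuous.
  apply: (@continuousB R R _ (cst 1) (fun z => \sum_k b z k)); first exact: cst_continuous.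
  by apply: continuous_big; [exact: add_continuous|move=> k _; exact: b_cont].
have bx i : b x i = 0 by rewrite /b subrr mul0mx mxE.
have wx i : w x i = nu i.
  by rewrite /w bx add0r big1 // subr0 mul1r.
have w_near : \forall z \near x, forall i, 0 < w z i.
  apply: (@filter_forall _ _ (fun i z => 0 < w z i) (nbhs x)) => i.
  have := w_cont i x; rewrite /continuous_at wx => /cvgr_gt; apply; exact: nu0.
have D_hull z : convex_hull (range p) z -> (z - x <= D)%MS.
  move=> /convex_hull_rangeP [v [v0 v1 ->]].
  rewrite -[x]scale1r -v1 scaler_suml -sumrB summx_sub // => i _.
  rewrite -scalerBr scalemx_sub // (_ : p i - x = row (enum_rank i) D) ?row_sub //.
  by rewrite rowK enum_rankK.
rewrite /within /=; near=> z => -[m [a [q [a1 qP zE]]]].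
have zD : (z - x <= D)%MS.
  rewrite zE -[x]scale1r -a1 scaler_suml -sumrB summx_sub // => k _.
  by rewrite -scalerBr scalemx_sub // D_hull.
apply/convex_hull_rangeP; exists (w z); split.
- by move=> i; apply/ltW; move: i; near: z.
- by rewrite big_split /= -mulr_sumr nu1 mulr1 addrCA subrr addr0.
have zxE : z - x = \sum_i b z i *: (p i - x).
  rewrite -[LHS](mulmxKpV zD) mulmx_sum_row.
  rewrite [RHS](reindex _ (onW_bij _ (enum_val_bij I))) /=.
  by apply: eq_bigr => i _; rewrite rowK /b enum_valK.
under eq_bigr do rewrite scalerDl -scalerA.
rewrite big_split /= -scaler_sumr -/x scalerBl scale1r addrCA addrC.
apply/eqP; rewrite -subr_eq zxE scaler_suml -sumrB; apply/eqP/eq_bigr => i _.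
by rewrite scalerBr.
Unshelve. all: by end_near.
Qed.

(** The point [y] has coefficients [v] supported in the support of [mu], and also positive
    coefficients [nu]. Adding [e * (nu - v)] to [mu] preserves the mean; it is positive off the
    support, where [v] vanishes, and on the support for small [e]. *)
Lemma nonseparable_mean (R : realType) (I : finType) (n : nat) (p : I -> 'rV[R]_n)
    (mu : I -> R) (y : 'rV[R]_n) :
  (forall i, 0 <= mu i) -> \sum_i mu i = 1 ->
  convex_hull (p @` [set` [set i | mu i != 0]%SET])%classic y ->
  relative_interior (convex_hull (range p)) y ->
  exists nu : I -> R,
    [/\ forall i, 0 < nu i, \sum_i nu i = 1
      & \sum_i nu i *: p i = \sum_i mu i *: p i].
Proof.
move=> mu0 mu1 /convex_hullP [w [w0 w1 yw]].
move=> /relative_interior_mean [nu [nu0 nu1 ynu]].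
pose F := [set i | mu i != 0]%SET.
pose v i := if i \in F then w i else 0.
have v1 : \sum_i v i = 1 by rewrite -big_mkcond.
have yv : y = \sum_i v i *: p i.
  rewrite yw big_mkcond; apply: eq_bigr => i _.
  by rewrite /v; case: ifP; rewrite ?scale0r.
have [e e0 eP] : exists2 e : R, 0 < e & forall i, mu i != 0 -> e * v i < mu i.
  (* Since [v i <= 1], half the least nonzero value of [mu] is small enough; the halving makes the
     inequality strict. *)
  exists (\big[Num.min/1]_(i | mu i != 0) (mu i / 2)).
    elim/big_ind: _ => // [a c a0 c0|i mui]; first by rewrite lt_min a0.
    by rewrite divr_gt0 // lt0r mui mu0.
  move=> i mui; have mui0 : 0 < mu i by rewrite lt0r mui mu0.
  apply: (@le_lt_trans _ _ (mu i / 2)); last by rewrite ltr_pdivrMr // ltr_pMr // ltr1n.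
  rewrite -[leRHS]mulr1 ler_pM //.
  - by apply: le_bigmin => // k muk; rewrite divr_ge0.
  - by rewrite /v; case: ifP.
  - exact: bigmin_le_cond.
  - rewrite -v1 (bigD1 i) //= lerDl sumr_ge0 // => k _.
    by rewrite /v; case: ifP.
exists (fun i => mu i + e * (nu i - v i)); split.
- move=> i; have [mui|/eP] := eqVneq (mu i) 0.
    by rewrite mui add0r /v inE mui eqxx subr0 mulr_gt0.
  by rewrite -subr_gt0 mulrBr addrCA => /(ltr_wpDl _); apply; rewrite mulr_ge0 // ltW.
- by rewrite big_split /= -mulr_sumr sumrB mu1 nu1 v1 subrr mulr0 addr0.
under eq_bigr do rewrite scalerDl -scalerA scalerBl.
by rewrite big_split /= -scaler_sumr sumrB -ynu -yv subrr scaler0 addr0.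
Qed.

(** * Spanning trees, expected degrees and log-linear distributions *)

(** The empty edge set is acyclic and extends to a maximal acyclic set. This makes the normalising
    sum of tree weights positive. *)
Lemma sptree_exists (V : finType) (adj : rel V) : exists T : sptree adj, True.
Proof.
have ac0 : `[< acyclic (finset.set0 : {set edge adj}) >].
  apply/asboolP => -[[|u s] []] // _; rewrite /ucycle => /andP[+ _].
  by case: s => [|v s] /= /andP[/existsP[f]]; rewrite inE.
by have [T Tmax _] := maxset_exists (P := fun F => `[< acyclic F >]) ac0; exists (exist _ T Tmax).
Qed.

Lemma tree_vectorE (R : realType) (V : finType) (adj : rel V) (T : sptree adj)
    (f : edge adj) : tree_vector R T 0 (enum_rank f) = (f \in val T)%:R.
Proof.
rewrite summxE; under eq_bigr do rewrite mxE eqxx /= (inj_eq enum_rank_inj).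
have [fT|fT] := boolP (f \in val T).
  rewrite (bigD1 f) //= eqxx big1 ?addr0 // => g /andP[_ gf].
  by rewrite eq_sym (negPf gf).
by rewrite big1 // => g gT; case: eqP => // fg; rewrite fg gT in fT.
Qed.

(** Double counting: [deg T v] is the sum of the coordinates of [e_T] at the edges containing
    [v]. *)
Lemma expected_degreeE (R : realType) (V : finType) (adj : rel V)
    (mu : sptree adj -> R) (v : V) :
  expected_degree mu v =
  \sum_(f : edge adj | v \in val f)
    (\sum_T mu T *: tree_vector R T) 0 (enum_rank f).
Proof.
under [RHS]eq_bigr do rewrite summxE; rewrite exchange_big /=.
apply: eq_bigr => T _; under eq_bigr do rewrite mxE tree_vectorE.
rewrite -mulr_sumr -natr_sum; congr (_ * _%:R).
rewrite /deg -sum1dep_card big_mkcond /= [RHS]big_mkcond; apply: eq_bigr => f _.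
by case: (f \in val T); case: (v \in val f).
Qed.

Lemma tree_weight_gt0 (R : realType) (V : finType) (adj : rel V)
    (c : edge adj -> R) (T : sptree adj) : weights c -> 0 < tree_weight c T.
Proof. by move=> c0; apply: prodr_gt0. Qed.

Lemma sum_tree_weight_gt0 (R : realType) (V : finType) (adj : rel V)
    (c : edge adj -> R) : weights c -> 0 < \sum_(T : sptree adj) tree_weight c T.
Proof.
move=> c0; have [T _] := sptree_exists V adj.
rewrite (bigD1 T) //= ltr_pwDl ?tree_weight_gt0 // sumr_ge0 // => S _.
exact/ltW/tree_weight_gt0.
Qed.

Definition log_linear (R : realType) (V : finType) (adj : rel V)
    (c : edge adj -> R) (T : sptree adj) : R :=
  tree_weight c T / \sum_(T' : sptree adj) tree_weight c T'.
Arguments log_linear {R V adj}.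

(** The relative resistance of an edge is the probability that a log-linear random tree contains it,
    a coordinate of the mean. *)
Lemma curvatureE (R : realType) (V : finType) (adj : rel V)
    (c : edge adj -> R) (v : V) :
  curvature c v = 1 - 2^-1 * expected_degree (log_linear c) v.
Proof.
rewrite expected_degreeE; congr (1 - _ * _); apply: eq_bigr => f _.
rewrite summxE /rel_resistance mulr_suml big_mkcond; apply: eq_bigr => T _.
by rewrite mxE tree_vectorE; case: ifP; rewrite ?mulr1 ?mulr0.
Qed.

Lemma log_linear_gt0 (R : realType) (V : finType) (adj : rel V)
    (c : edge adj -> R) (T : sptree adj) : weights c -> 0 < log_linear c T.
Proof. by move=> c0; rewrite divr_gt0 ?tree_weight_gt0 ?sum_tree_weight_gt0. Qed.

Lemma log_linear_sum (R : realType) (V : finType) (adj : rel V)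
    (c : edge adj -> R) : weights c -> \sum_T log_linear c T = 1.
Proof. by move=> c0; rewrite -mulr_suml divff // gt_eqF // sum_tree_weight_gt0. Qed.

Lemma log_linear_distribution (R : realType) (V : finType) (adj : rel V)
    (c : edge adj -> R) : weights c -> tree_distribution (log_linear c).
Proof.
move=> c0; split=> [T|]; last exact: log_linear_sum.
have ge0 S : 0 <= log_linear c S by exact/ltW/log_linear_gt0.
by rewrite ge0 -(log_linear_sum _ _ _ _ c0) (bigD1 T) //= lerDl sumr_ge0.
Qed.

(** The support is the set of all trees, so the mean itself witnesses non-separability. *)
Lemma positive_nonseparable (R : realType) (V : finType) (adj : rel V)
    (mu : sptree adj -> R) :
  (forall T, 0 < mu T) -> \sum_T mu T = 1 ->
  nonseparable R [set T | mu T != 0]%SET.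
Proof.
move=> mu0 mu1; exists (\sum_T mu T *: tree_vector R T).
have allT T : (T \in [set T | mu T != 0]%SET) = true by rewrite inE gt_eqF.
split; last exact: mean_relative_interior.
apply/convex_hullP; exists mu; split; first by move=> T; exact: ltW.
  by rewrite -mu1; apply: eq_bigl => T; rewrite allT.
by apply: eq_bigl => T; rewrite allT.
Qed.

Lemma has_type_nonseparable (R : realType) (V : finType) (adj : rel V)
    (k : distr_type) (mu : sptree adj -> R) :
  tree_distribution mu -> has_type k mu -> nonseparable R [set T | mu T != 0]%SET.
Proof.
case: k => [//| |] [_ mu1].
  by move=> mu0; exact: positive_nonseparable.
move=> [c [c0 muE]]; apply: positive_nonseparable => // T.
by rewrite muE; exact: log_linear_gt0.
Qed.

Lemma log_linear_has_type (R : realType) (V : finType) (adj : rel V)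
    (k : distr_type) (c : edge adj -> R) :
  weights c -> has_type k (log_linear c).
Proof.
move=> c0; case: k => /=.
- apply: positive_nonseparable; last exact: log_linear_sum.
  by move=> T; exact: log_linear_gt0.
- by move=> T; exact: log_linear_gt0.
- by exists c.
Qed.

Lemma log_linear_same_degrees (R : realType) (V : finType) (adj : rel V)
    (mu : sptree adj -> R) :
  tree_distribution mu -> nonseparable R [set T | mu T != 0]%SET ->
  exists2 c : edge adj -> R, weights c
    & expected_degree (log_linear c) = expected_degree mu.
Proof.
move=> [mu01 mu1] [y [yF yP]].
have mu0 T : 0 <= mu T by have /andP[] := mu01 T.
have [nu [nu0 nu1 nuE]] := nonseparable_mean _ _ _ _ _ _ mu0 mu1 yF yP.
have [th thE] := log_linear_mean _ _ _ (tree_vector R (adj:=adj)) _ nu0 nu1.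
(* With these weights [expR <th, e_T>] is the product of [c] over the edges of [T]. *)
pose c (f : edge adj) := expR (th 0 (enum_rank f)).
have c0 : weights c by move=> f; exact: expR_gt0.
exists c => //; apply/funext => v; rewrite !expected_degreeE.
suff -> : \sum_T log_linear c T *: tree_vector R T = \sum_T mu T *: tree_vector R T by [].
rewrite -nuE; move: thE; cbv zeta.
have wE T : expR (\sum_j th 0 j * tree_vector R T 0 j) = tree_weight c T.
  rewrite /tree_weight -expR_sum; congr expR.
  rewrite (reindex _ (onW_bij _ (enum_rank_bij (edge adj)))) [RHS]big_mkcond.
  by apply: eq_bigr => f _; rewrite tree_vectorE; case: ifP; rewrite ?mulr1 ?mulr0.
under eq_bigr do rewrite wE; under [X in X *: _]eq_bigr do rewrite wE.
move=> wsum; have Z0 := sum_tree_weight_gt0 R V adj c c0.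
apply: (scalerI (lt0r_neq0 Z0)); rewrite -[RHS]wsum scaler_sumr.
by apply: eq_bigr => T _; rewrite scalerA mulrC divfK ?lt0r_neq0.
Qed.

Theorem theorem3p8 (R : realType) (V : finType) (adj : rel V)
    (graph_adj : simple_connected_graph adj) (k : distr_type) :
  (resistance_nonnegative R adj <->
    exists mu : sptree adj -> R,
      [/\ tree_distribution mu, has_type k mu
        & forall v : V, expected_degree mu v <= 2]) /\
  (resistance_positive R adj <->
    exists mu : sptree adj -> R,
      [/\ tree_distribution mu, has_type k mu
        & forall v : V, expected_degree mu v < 2]).
Proof.
have curv_ge0 c v : (0 <= curvature c v) =
    (expected_degree (log_linear c) v <= 2).
  by rewrite curvatureE subr_ge0 mulrC ler_pdivrMr // mul1r.
have curv_gt0 c v : (0 < curvature c v) =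
    (expected_degree (log_linear c) v < 2).
  by rewrite curvatureE subr_gt0 mulrC ltr_pdivrMr // mul1r.
(* Forwards, the log-linear distribution of the given weights has all three types. Backwards, each
   type implies non-separability, the weakest of the three, and a log-linear distribution with the
   same expected degrees supplies the weights. *)
split; split.
- move=> [c [c0 pc]]; exists (log_linear c).
  split; [exact: log_linear_distribution|exact: log_linear_has_type|].
  by move=> v; rewrite -curv_ge0.
- move=> [mu [mud muk mu2]].
  have [c c0 cE] := log_linear_same_degrees _ _ _ _ mud (has_type_nonseparable _ _ _ _ _ mud muk).
  by exists c; split=> // v; rewrite curv_ge0 cE.
- move=> [c [c0 pc]]; exists (log_linear c).
  split; [exact: log_linear_distribution|exact: log_linear_has_type|].
  by move=> v; rewrite -curv_gt0.
- move=> [mu [mud muk mu2]].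
  have [c c0 cE] := log_linear_same_degrees _ _ _ _ mud (has_type_nonseparable _ _ _ _ _ mud muk).
  by exists c; split=> // v; rewrite curv_gt0 cE.
Qed.
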